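(* Let $\mathcal S$ be an irreducible c.s.r. semigroup of real $2\times2$ matrices and let $r$ be the minimal rank of matrices from $\mathcal S$. Then, in a suitable basis of $\mathbb R^2$: if $r=2$, then $\mathcal S$ consists of orthogonal matrices; if $r=1$, then $\mathcal S$ consists of compositions of the following operators, where $\mathbf Q$ is a square centered at the origin: 1) projections onto a diagonal of $\mathbf Q$ parallel to a side of $\mathbf Q$ (4 operators); 2) orthogonal transforms of $\mathbf Q$ (two rotations by $\pi/2$, four axial symmetries, and the central symmetry).
   Context: Matrix semigroups are multiplicative and, as assumed in the paper, topologically closed. A matrix semigroup is c.s.r. (has constant spectral radius) if the spectral radius (maximal modulus of eigenvalues) of all its elements is the same and nonzero. A family of $2\times2$ matrices is irreducible if there is no one-dimensional linear subspace of $\mathbb R^2$ invariant for all its matrices. ''In a suitable basis'' means after replacing all $A\in\mathcal S$ by $T^{-1}AT$ with one invertible real matrix $T$. *)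

(* Defs.v *)
From mathcomp Require Export all_boot all_order all_algebra.
From mathcomp Require Export all_classical all_reals all_analysis.
From mathcomp Require Export complex.

Set Implicit Arguments.
Unset Strict Implicit.
Unset Printing Implicit Defensive.

Import Order.TTheory GRing.Theory Num.Theory numFieldNormedType.Exports.

Local Open Scope classical_set_scope.
Local Open Scope ring_scope.

Section MatrixSemigroups.
Context {R : realType}.
Implicit Types (A B T : 'M[R]_2) (S G : set 'M[R]_2) (p v : 'cV[R]_2).

Definition complex_eigenvalue A (z : R[i]) : bool :=
  eigenvalue (map_mx (real_complex R) A) z.

Definition is_spectral_radius A (rho : R) : Prop :=
  (exists2 z, complex_eigenvalue A z & ComplexField.Normc.normc z = rho) /\
  (forall z, complex_eigenvalue A z -> ComplexField.Normc.normc z <= rho).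

Definition matrix_semigroup S : Prop :=
  (forall A B, S A -> S B -> S (A *m B)) /\ closed S.

Definition constant_spectral_radius S : Prop :=
  exists2 c : R, c != 0 & forall A, S A -> is_spectral_radius A c.

Definition irreducible_family S : Prop :=
  ~ exists L : {vspace 'cV[R]_2},
      \dim L = 1%N /\ forall A, S A -> forall v, v \in L -> A *m v \in L.

Definition is_min_rank S (r : nat) : Prop :=
  (exists2 A, S A & \rank A = r) /\ forall A, S A -> (r <= \rank A)%N.

Definition change_basis T S : set 'M[R]_2 :=
  [set invmx T *m A *m T | A in S].

Definition orthogonal_matrix A : Prop := A^T *m A = 1%:M.

(* The subsemigroup generated by G. *)
Inductive compositions G : set 'M[R]_2 :=
| compositions_gen A of G A : compositions G A
| compositions_mul A B of compositions G A & compositions G B :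
    compositions G (A *m B).

(* The matrix with columns e_1 and - e_0: rotation by pi/2. *)
Definition quarter_turn : 'M[R]_2 := delta_mx 1 0 - delta_mx 0 1.

(* A square centered at the origin is determined by one of its vertices
   p != 0: the vertices, in cyclic order, are the images of p under the
   rotations by k * pi/2 (so the index k only matters modulo 4). *)
Definition square_vertex p (k : nat) : 'cV[R]_2 := quarter_turn ^+ k *m p.

Definition square p : set 'cV[R]_2 :=
  [set v | exists w : 'I_4 -> R,
     [/\ forall k, 0 <= w k, \sum_k w k = 1
       & v = \sum_k w k *: square_vertex p k]].

Definition square_diagonal p (k : nat) : {vspace 'cV[R]_2} :=
  <[square_vertex p k]>%VS.

Definition square_side_direction p (k : nat) : {vspace 'cV[R]_2} :=
  <[square_vertex p k.+1 - square_vertex p k]>%VS.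

(* P is the projection onto L parallel to M; this determines P when L and M
   are complementary, as are a diagonal and a side direction of a square. *)
Definition is_projection (L M : {vspace 'cV[R]_2}) (P : 'M[R]_2) : Prop :=
  forall v, P *m v \in L /\ v - P *m v \in M.

(* There are two diagonals and two side directions, hence four such P. *)
Definition diagonal_projections p : set 'M[R]_2 :=
  [set P | exists k l,
     is_projection (square_diagonal p k) (square_side_direction p l) P].

(* The full symmetry group of the square: the rotations by +-pi/2, the four
   axial symmetries, the central symmetry, and the identity (which is in any
   case a composition of the others). *)
Definition square_symmetries p : set 'M[R]_2 :=
  [set U | orthogonal_matrix U /\ [set U *m v | v in square p] = square p].

End MatrixSemigroups.

(* Main.v *)
Require Import Defs.
From mathcomp Require Import ring lra.

Import Order.TTheory GRing.Theory Num.Theory numFieldNormedType.Exports.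
Import ComplexField.Normc.
Local Open Scope classical_set_scope.
Local Open Scope ring_scope.

(* Comparing the eigenvalues of A and A^2 shows that the common spectral radius
   is 1.
   r = 1: let a g (column times row) be a rank one element of S.  By
   irreducibility there are B, C in S such that the columns a, b = B a are
   independent, and so are the rows g, h = g C.  For D in S the matrices D a g,
   D a h, D b g, D b h are rank one elements of S, so their traces, which are
   the values of g and h at D a and D b, are +-1; the same holds for D = 1.
   Hence in the basis (a, b) the columns of D are +-e_0 or +-e_1: D is a signed
   permutation or, up to sign, one of the four projections.
   r = 2: if |det A| < 1, then A^(2n) tends to a singular projection; hence
   |det A| = 1, with |tr A| <= 2, and tr A = 0 when det A = -1.  A nonscalar
   element with det A = 1 and |tr A| = 2 is parabolic: the boundedness of
   tr (A^(2n) B) forces its fixed line to be invariant under S.  So S contains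
   an elliptic A, a rotation by a nonzero angle in a suitable basis, and by
   recurrence S contains the inverses of its elliptic elements.  In that basis
   the trace of A B A^-1 B^-1 exceeds 2 unless B, of determinant 1, is
   orthogonal; if det B = -1, then tr B = tr (A B) = 0 makes B orthogonal. *)

(** * Entries, determinant, trace and eigenvalues of 2 x 2 matrices *)

Lemma sum_ord2 (V : nmodType) (F : 'I_2 -> V) : \sum_(k < 2) F k = F 0 + F 1.
Proof.
rewrite !big_ord_recl big_ord0 addr0; congr (_ + F _); exact: val_inj.
Qed.

Lemma ord2P (P : 'I_2 -> Prop) : P 0 -> P 1 -> forall i, P i.
Proof.
move=> P0 P1 [[|[|//]] i].
  by rewrite (_ : Ordinal i = 0)//; exact: val_inj.
by rewrite (_ : Ordinal i = 1)//; exact: val_inj.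
Qed.

Lemma mx2P (V : Type) (A B : 'M[V]_2) : A 0 0 = B 0 0 -> A 0 1 = B 0 1 ->
  A 1 0 = B 1 0 -> A 1 1 = B 1 1 -> A = B.
Proof. by move=> *; apply/matrixP; apply: ord2P; apply: ord2P. Qed.

Lemma col2P (V : Type) (u v : 'cV[V]_2) :
  u 0 0 = v 0 0 -> u 1 0 = v 1 0 -> u = v.
Proof. by move=> *; apply/matrixP; apply: ord2P => j; rewrite (ord1 j). Qed.

Lemma mulmx2E (V : pzSemiRingType) m n
    (A : 'M[V]_(m, 2)) (B : 'M[V]_(2, n)) i j :
  (A *m B) i j = A i 0 * B 0 j + A i 1 * B 1 j.
Proof. by rewrite mxE sum_ord2. Qed.

Lemma det_mx2 (V : comPzRingType) (A : 'M[V]_2) :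
  \det A = A 0 0 * A 1 1 - A 0 1 * A 1 0.
Proof.
rewrite (expand_det_row _ 0) sum_ord2 /cofactor !det_mx11 !mxE /=.
have -> : lift 0 0 = 1 :> 'I_2 by apply: val_inj.
have -> : lift 1 0 = 0 :> 'I_2 by apply: val_inj.
by rewrite expr0 expr1 mul1r mulN1r mulrN.
Qed.

Lemma mxtrace2 (V : nmodType) (A : 'M[V]_2) : \tr A = A 0 0 + A 1 1.
Proof. by rewrite /mxtrace sum_ord2. Qed.

Lemma eigenvalue_mx2 (F : fieldType) (A : 'M[F]_2) z :
  eigenvalue A z = (z ^+ 2 - \tr A * z + \det A == 0).
Proof.
rewrite /eigenvalue /eigenspace kermx_eq0 row_free_unit unitmxE unitfE negbK.
congr (_ == 0); rewrite !det_mx2 mxtrace2 !mxE /=; ring.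
Qed.

(** * The common spectral radius, and its meaning for trace and determinant *)

Section SpectralRadius.
Context {R : realType}.
Implicit Types (A B : 'M[R]_2) (z w : R[i]).

Lemma normc_ge0 z : 0 <= normc z.
Proof. by case: z => x y; exact: sqrtr_ge0. Qed.

Lemma normcX z n : normc (z ^+ n) = normc z ^+ n.
Proof. by elim: n => [|n IHn]; rewrite ?normc1// !exprS normcM IHn. Qed.

Lemma sqr_normc z : normc z ^+ 2 = complex.Re z ^+ 2 + complex.Im z ^+ 2.
Proof. by case: z => x y /=; rewrite sqr_sqrtr// addr_ge0 ?sqr_ge0. Qed.

Lemma complex_eigenvalueE A z : complex_eigenvalue A z =
  (z ^+ 2 - (real_complex R (\tr A)) * z + real_complex R (\det A) == 0).
Proof. by rewrite /complex_eigenvalue eigenvalue_mx2 det_map_mx trace_map_mx.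
  Qed.

(** The two roots of the characteristic polynomial add up to the trace. *)
Lemma complex_eigenvalue_other A z :
  complex_eigenvalue A z -> complex_eigenvalue A (real_complex R (\tr A) - z).
Proof. by rewrite !complex_eigenvalueE => /eqP <-; apply/eqP; ring. Qed.

Lemma complex_eigenvalue_sqr A z : complex_eigenvalue A z ->
  forall w, complex_eigenvalue (A *m A) w =
    (w == z ^+ 2) || (w == (real_complex R (\tr A) - z) ^+ 2).
Proof.
rewrite complex_eigenvalueE => /eqP zA w; rewrite complex_eigenvalueE.
rewrite -[w == z ^+ 2]subr_eq0 -[w == _ ^+ 2]subr_eq0 -mulf_eq0; congr (_ == 0).
have -> : \tr (A *m A) = \tr A ^+ 2 - \det A *+ 2.
  rewrite !mxtrace2 det_mx2 !mulmx2E; ring.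
have dE : real_complex R (\det A) = real_complex R (\tr A) * z - z ^+ 2.
  by apply/eqP; rewrite -subr_eq0 -zA; apply/eqP; ring.
rewrite det_mulmx rmorphM rmorphB rmorphXn rmorphMn /= dE; ring.
Qed.

Lemma constant_spectral_radius_eq1 (S : set 'M[R]_2) A :
  matrix_semigroup S -> constant_spectral_radius S -> S A ->
  is_spectral_radius A 1.
Proof.
move=> [SM _] [c c0 Sc] SA; have Ac := Sc _ SA.
have [[w ww wc] AAc] := Sc _ (SM _ _ SA SA).
have [[z zz zc] Az] := Ac.
suff <- : c = 1 by [].
have c_gt0 : 0 < c by rewrite lt_neqAle eq_sym c0 -zc normc_ge0.
have le1 : c ^+ 2 <= c.
  have := AAc (z ^+ 2); rewrite normcX zc (complex_eigenvalue_sqr _ _ zz) eqxx.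
  exact.
(* An eigenvalue of [A *m A] of modulus [c] is the square of an eigenvalue of [A]. *)
have le2 : c <= c ^+ 2.
  move: ww; rewrite (complex_eigenvalue_sqr _ _ zz) => /orP[] /eqP wE.
    by move: wc; rewrite wE normcX zc => ->.
  move: wc; rewrite wE normcX => wc; rewrite -[leLHS]wc.
  apply: lerXn2r; rewrite ?nnegrE ?normc_ge0 ?(ltW c_gt0)//.
  exact/Az/complex_eigenvalue_other.
apply: (mulfI c0); rewrite mulr1 -expr2; apply/le_anti; rewrite le1 le2//.
Qed.

(** A nonreal eigenvalue on the unit circle comes with its conjugate, which gives the first case. A
    real one is 1 or -1; the other eigenvalue is then [\det A] or [- \det A], which gives the
    second. *)
Lemma spectral_radius1P A : is_spectral_radius A 1 ->
  (\det A = 1 /\ `|\tr A| < 2) \/ (`|\tr A| = 1 + \det A /\ `|\det A| <= 1).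
Proof.
case=> [[[x y]]] zA nz rA; have := complex_eigenvalue_other _ _ zA.
move: zA; rewrite complex_eigenvalueE.
have {}nz : x ^+ 2 + y ^+ 2 = 1
  by have := sqr_normc (Complex x y); rewrite nz /= expr1n => <-.
have [t tE] : {t | t = \tr A} by exists (\tr A).
have [d dE] : {d | d = \det A} by exists (\det A).
rewrite -tE -dE => /eqP zA other.
have /eqP := congr1 (@complex.Re R) zA; have /eqP := congr1 (@complex.Im R) zA.
rewrite /= => /eqP im0 /eqP re0.
have {}im0 : y * (2 * x - t) = 0 by move: im0; lra.
have {}re0 : x ^+ 2 - y ^+ 2 - t * x + d = 0 by move: re0; rewrite !expr2; lra.
have := rA _ other; rewrite /= sub0r => le1.
have {}le1 : (t - x) ^+ 2 + y ^+ 2 <= 1.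
  rewrite -[X in _ + X]sqrrN -[leLHS]sqr_sqrtr ?addr_ge0 ?sqr_ge0//.
  by rewrite expr_le1// sqrtr_ge0.
have [y0|y0] := eqVneq y 0.
  right; subst y; rewrite ?(expr0n, addr0, subr0) /= in nz re0 le1.
  have : (x - 1) * (x + 1) = 0
    by have := subrr (1 : R); rewrite -{1}nz => <-; ring.
  have : -1 <= t - x <= 1 by apply/andP; split; nra.
  move=> /andP[l1 l2] /eqP; rewrite mulf_eq0 => /orP[] /eqP xE.
    have {xE} xE : x = 1 by lra.
    subst x; rewrite expr1n in re0.
    split; last by rewrite ler_norml; apply/andP; lra.
    by rewrite ger0_norm; lra.
  have {xE} xE : x = -1 by lra.
  subst x; rewrite sqrrN expr1n in re0.
  split; last by rewrite ler_norml; apply/andP; lra.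
  by rewrite ler0_norm; lra.
left; have xE : t = 2 * x.
  by apply/eqP; rewrite eq_sym -subr_eq0; move/eqP: im0;
    rewrite mulf_eq0 (negPf y0).
split; first by subst t; move: nz re0; nra.
have y2 : 0 < y ^+ 2 by rewrite exprn_even_gt0.
by rewrite ltr_norml xE; apply/andP; split; nra.
Qed.

End SpectralRadius.

(** * Irreducibility as a determinant condition *)

Section Irreducible.
Context {R : realType}.
Implicit Types (A B D T M : 'M[R]_2) (S : set 'M[R]_2) (u v x y : 'cV[R]_2).

(** The determinant with columns [u] and [v]: it is nonzero exactly when they are independent. *)
Definition cross u v : R := u 0 0 * v 1 0 - u 1 0 * v 0 0.

Lemma cross_eq0 u v : u != 0 -> cross u v = 0 -> exists k, v = k *: u.
Proof.
move=> u0 uv0; rewrite /cross in uv0; have [u00|u00] := eqVneq (u 0 0) 0.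
  have u10 : u 1 0 != 0.
    by apply: contraNneq u0 => u10; apply/eqP/col2P; rewrite !mxE.
  exists (v 1 0 / u 1 0); apply: col2P; rewrite !mxE ?mulfVK// u00 mulr0.
  apply: (mulfI u10); rewrite mulr0; move: uv0; rewrite u00 mul0r sub0r.
  by move=> /eqP; rewrite oppr_eq0 => /eqP.
exists (v 0 0 / u 0 0); apply: col2P; rewrite !mxE ?mulfVK//.
by apply: (mulfI u00); move/subr0_eq: uv0 => ->; field.
Qed.

(** Otherwise the line spanned by [u] would be invariant. *)
Lemma irreducible_cross S u : irreducible_family S -> u != 0 ->
  exists2 A, S A & cross u (A *m u) != 0.
Proof.
move=> irrS u0; apply: contrapT => noA; apply: irrS; exists <[u]>%VS.
split=> [|A SA _ /vlineP[k ->]]; first by rewrite dim_vline u0.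
have [|l Au] := cross_eq0 u (A *m u) u0.
  by apply/eqP; apply: contrapT => /negP Au; apply: noA; exists A.
by rewrite -scalemxAr Au !memvZ ?memv_line.
Qed.

End Irreducible.

(** * Semigroups containing a matrix of rank one *)

Section RankOne.
Context {R : realType}.
Implicit Types (A B D K T M : 'M[R]_2) (S : set 'M[R]_2).

Definition signed_basis_columns M : Prop := forall j,
  (`|M 0 j| = 1 /\ M 1 j = 0) \/ (M 0 j = 0 /\ `|M 1 j| = 1).

(** Up to signs the rows of the invertible matrix [K] are (1, 1) and (1, -1). A column (x, y) of [M]
    thus has |x + y| = |x - y| = 1, so one coordinate vanishes and the other is 1 or -1. *)
Lemma signed_basis_columnsP K M : \det K != 0 ->
  (forall i j, `|K i j| = 1) -> (forall i j, `|(K *m M) i j| = 1) ->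
  signed_basis_columns M.
Proof.
move=> + K1 KM j; rewrite det_mx2.
have sgn (a : R) : `|a| = 1 -> a = 1 \/ a = -1.
  by move=> /eqP; rewrite eqr_norml ler01 andbT => /orP[] /eqP; [left|right].
have := sgn _ (KM 0 j); have := sgn _ (KM 1 j); rewrite !mulmx2E.
set x := M 0 j; set y := M 1 j.
suff H : (K 0 0 * K 1 1 - K 0 1 * K 1 0 != 0) ->
   K 1 0 * x + K 1 1 * y = 1 \/ K 1 0 * x + K 1 1 * y = -1 ->
   K 0 0 * x + K 0 1 * y = 1 \/ K 0 0 * x + K 0 1 * y = -1 ->
   ((x = 1 \/ x = -1) /\ y = 0) \/ (x = 0 /\ (y = 1 \/ y = -1)).
  move=> h1 h0 /H /(_ h1 h0) [[[] -> ->]|[-> [] ->]];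
    rewrite ?normrN normr1; by [left|right].
have [] := sgn _ (K1 0 0) => ->; have [] := sgn _ (K1 0 1) => ->;
have [] := sgn _ (K1 1 0) => ->; have [] := sgn _ (K1 1 1) => ->;
rewrite ?mulNr ?mulrN ?mulr1 ?opprK ?subrr ?addNr ?eqxx // => _ [] e1 [] e0;
first [ left; split; [left; lra | lra] | left; split; [right; lra | lra]
      | right; split; [lra | left; lra] | right; split; [lra | right; lra]].
Qed.

Lemma rank1_semigroup S : matrix_semigroup S -> irreducible_family S ->
  (forall A, S A -> is_spectral_radius A 1) ->
  (exists2 A, S A & \rank A = 1%N) ->
  exists2 T, T \in unitmx &
    forall D, S D -> signed_basis_columns (invmx T *m D *m T).
Proof.
move=> [SM _] irrS rad1 [A SA rA].
have [a [g AE]] : exists (a : 'cV[R]_2) (g : 'rV[R]_2), A = a *m g.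
  by move: (mulmx_base A); move: (col_base A) (row_base A);
    rewrite rA => a g <-; exists a, g.
(* [u *m v] has determinant 0 and trace [v *m u], so its only possible nonzero eigenvalue is this
   trace. *)
have norm1 (u : 'cV[R]_2) (v : 'rV[R]_2) : S (u *m v) -> `|(v *m u) 0 0| = 1.
  move=> Suv; have := spectral_radius1P _ (rad1 _ Suv).
  rewrite mxtrace_mulC trace_mx11.
  have -> : \det (u *m v) = 0 by rewrite det_mx2 !mxE !big_ord1; ring.
  by rewrite addr0 => -[[]|[]] // /eqP; rewrite eq_sym oner_eq0.
have A0 : A != 0 by rewrite -mxrank_eq0 rA.
have a0 : a != 0 by apply: contraNneq A0 => a0; rewrite AE a0 mul0mx.
have g0 : g != 0 by apply: contraNneq A0 => g0; rewrite AE g0 mulmx0.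
have [B SB aB] := irreducible_cross S a irrS a0.
(* [y] spans the kernel of [g]. If [C] moves this line, then [g *m C] does not vanish on [y], hence
   is independent of [g]. *)
pose y : 'cV[R]_2 := \col_i (if i == 0 then - g 0 1 else g 0 0).
have y0 : y != 0.
  apply: contraNneq g0 => /matrixP y0; apply/eqP/matrixP => i; rewrite (ord1 i).
  have := y0 0 0; have := y0 1 0; rewrite !mxE /= => g00 /eqP;
    rewrite oppr_eq0 => /eqP g01.
  by apply: ord2P; rewrite mxE.
have [C SC yC] := irreducible_cross S y irrS y0.
pose xs (j : 'I_2) := if j == 0 then a else B *m a.
pose gs (i : 'I_2) := if i == 0 then g else g *m C.
pose T : 'M[R]_2 := \matrix_(k, j) xs j k 0.
pose G : 'M[R]_2 := \matrix_(i, k) gs i 0 k.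
have Tu : \det T != 0.
  move: aB; rewrite /cross; apply: contra_neq => e;
    rewrite -[RHS]e det_mx2 !mxE /=; ring.
have Gu : \det G != 0.
  move: yC; rewrite /cross; apply: contra_neq => e;
    rewrite -[RHS]oppr0 -[in RHS]e det_mx2.
  rewrite !mxE /= ?mulmx2E ?sum_ord2 ?mulmx2E !mxE /=; ring.
(* [D *m xs j *m gs i] lies in [S] because [a *m g] does. The identity, which need not lie in [S],
   is included to control the entries of [G *m T]. *)
have SX D : S D \/ D = 1%:M -> forall i j, `|(gs i *m D *m xs j) 0 0| = 1.
  move=> SD i j; rewrite -mulmxA; apply: norm1.
  have Sx : S (D *m xs j *m g).
    rewrite /xs; case: eqP => _; rewrite ?mulmxA -!mulmxA -AE ?mulmxA.
      by case: SD => [SD|->]; rewrite ?mul1mx; [exact: SM|].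
    by case: SD => [SD|->]; rewrite ?mul1mx; [apply: (SM) => //;
      exact: SM| exact: SM].
  by rewrite /gs; case: eqP => _ //; rewrite mulmxA; apply: SM.
have GTE D i j : (G *m D *m T) i j = (gs i *m D *m xs j) 0 0.
  by rewrite !mulmx2E !mxE.
exists T; first by rewrite unitmxE unitfE.
(* In the basis given by [T], multiplying [D] on the left by [G *m T] gives [G *m D *m T]; both
   matrices have entries 1 or -1. *)
move=> D SD; apply: (signed_basis_columnsP (G *m T)).
- by rewrite det_mulmx mulf_neq0.
- by move=> i j; rewrite -[G]mulmx1 GTE SX//; right.
- move=> i j; rewrite !mulmxA -[G *m T *m _]mulmxA mulmxV ?unitmxE ?unitfE//
  mulmx1.
  by rewrite GTE SX//; left.
Qed.

End RankOne.

(** * The square with vertices on the coordinate axes, as a unit ball of the sum norm *)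

Section Square.
Context {R : realType}.
Implicit Types (U M P : 'M[R]_2) (v : 'cV[R]_2).

Let e0 : 'cV[R]_2 := delta_mx 0 0.

Lemma quarter_turn_mul v :
  ((quarter_turn *m v) 0 0 = - v 1 0) * ((quarter_turn *m v) 1 0 = v 0 0).
Proof. by rewrite !mulmx2E !mxE /=; split; ring. Qed.

Lemma square_vertexS v k :
  square_vertex v k.+1 = quarter_turn *m square_vertex v k.
Proof. by rewrite /square_vertex exprS mulmxA. Qed.

Lemma square_vertex_e0 :
  ((square_vertex e0 0 = e0) * (square_vertex e0 1 = delta_mx 1 0) *
   (square_vertex e0 2 = - e0) * (square_vertex e0 3 = - delta_mx 1 0)).
Proof.
have v0 : square_vertex e0 0 = e0 by rewrite /square_vertex expr0 mul1mx.
have Q0 : quarter_turn *m e0 = delta_mx 1 0.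
  by apply: col2P; rewrite quarter_turn_mul !mxE ?oppr0.
have Q1 : quarter_turn *m delta_mx 1 0 = - e0.
  by apply: col2P; rewrite quarter_turn_mul !mxE ?oppr0.
by rewrite !square_vertexS v0 Q0 Q1 mulmxN Q0.
Qed.

Lemma sum_ord4 (V : nmodType) (F : 'I_4 -> V) :
  \sum_k F k = F 0 + F 1 + F 2 + F 3.
Proof.
by rewrite !big_ord_recl big_ord0 addr0 !addrA; congr (F _ + F _ + F _ + F _);
  apply: val_inj.
Qed.

Lemma square_e0E v : square e0 v <-> `|v 0 0| + `|v 1 0| <= 1.
Proof.
have vE (w : 'I_4 -> R) : \sum_k w k *: square_vertex e0 k =
    \col_i if i == 0 then w 0 - w 2 else w 1 - w 3.
  rewrite sum_ord4 (_ : (1 : 'I_4) = 1%N :> nat)// (_ : (2 : 'I_4) =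
    2%N :> nat)//.
  rewrite (_ : (3 : 'I_4) = 3%N :> nat)// !square_vertex_e0.
  by apply: col2P; rewrite !mxE /=; ring.
split.
  move=> [w [w0 w1 ->]]; rewrite vE !mxE /=; rewrite sum_ord4 in w1.
  move: w1 (w0 0) (w0 1) (w0 2) (w0 3).
  move: (w 0) (w 1) (w 2) (w 3) => a b c d abcd a0 b0 c0 d0.
  by case: (ger0P (a - c)); case: (ger0P (b - d)); lra.
(* Weights: each vertex gets the positive part of the coordinate in its direction plus a quarter of
   the slack, which cancels between opposite vertices. *)
move=> v1; pose s := (1 - `|v 0 0| - `|v 1 0|) / 4.
pose f (x : R) := (`|x| + x) / 2 + s.
exists (fun k : 'I_4 => nth 0 [:: f (v 0 0); f (v 1 0); f (- v 0 0);
  f (- v 1 0)] k).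
have f0 x : 0 <= f x
  by rewrite /f /s; have := ler_norm (- x); rewrite normrN; lra.
split.
- by move=> [[|[|[|[|//]]]] i] /=; exact: f0.
- by rewrite sum_ord4 /= /f /s !normrN; field.
- by rewrite vE; apply: col2P; rewrite !mxE /= /f /s normrN; field.
Qed.

(** The inverse [U^T] preserves the sum norm as well, so the unit ball is mapped onto itself. *)
Lemma square_symmetriesP U : orthogonal_matrix U ->
  (forall v, `|(U *m v) 0 0| + `|(U *m v) 1 0| = `|v 0 0| + `|v 1 0|) ->
  square_symmetries e0 U.
Proof.
move=> UU Un; split=> //; apply/seteqP; split=> [_ [v + <-]|v].
  by rewrite !square_e0E Un.
rewrite square_e0E => v1; exists (U^T *m v); last
  by rewrite mulmxA (mulmx1C UU) mul1mx.
by rewrite square_e0E -Un mulmxA (mulmx1C UU) mul1mx.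
Qed.

(** The image is the diagonal through [e0]; the kernel is spanned by (-1, 1) or (1, 1), both side
    directions. *)
Lemma projection_row0 P : P 0 0 = 1 -> `|P 0 1| = 1 -> P 1 0 = 0 -> P 1 1 = 0 ->
  diagonal_projections e0 P.
Proof.
move=> P00 /eqP; rewrite eqr_norml ler01 andbT => + P10 P11.
move=> /orP[] /eqP P01; [exists 0%N, 0%N|exists 0%N, 1%N] => v; split;
  apply/vlineP; rewrite !square_vertex_e0.
- exists (v 0 0 + v 1 0); apply: col2P;
  rewrite ?mulmx2E !mxE /= ?(P00, P01, P10, P11); ring.
- exists (v 1 0); apply: col2P;
  rewrite !mxE ?sum_ord2 /= ?(P00, P01, P10, P11); ring.
- exists (v 0 0 - v 1 0); apply: col2P;
  rewrite ?mulmx2E !mxE /= ?(P00, P01, P10, P11); ring.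
- exists (- v 1 0); apply: col2P;
  rewrite !mxE ?sum_ord2 /= ?(P00, P01, P10, P11); ring.
Qed.

Lemma projection_row1 P : P 1 1 = 1 -> `|P 1 0| = 1 -> P 0 0 = 0 -> P 0 1 = 0 ->
  diagonal_projections e0 P.
Proof.
move=> P11 /eqP; rewrite eqr_norml ler01 andbT => + P00 P01.
move=> /orP[] /eqP P10; [exists 1%N, 0%N|exists 1%N, 1%N] => v; split;
  apply/vlineP; rewrite !square_vertex_e0.
- exists (v 0 0 + v 1 0); apply: col2P;
  rewrite ?mulmx2E !mxE /= ?(P00, P01, P10, P11); ring.
- exists (- v 0 0); apply: col2P;
  rewrite !mxE ?sum_ord2 /= ?(P00, P01, P10, P11); ring.
- exists (v 1 0 - v 0 0); apply: col2P;
  rewrite ?mulmx2E !mxE /= ?(P00, P01, P10, P11); ring.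
- exists (- v 0 0); apply: col2P;
  rewrite !mxE ?sum_ord2 /= ?(P00, P01, P10, P11); ring.
Qed.

Lemma scalar_square_symmetry (c : R) : `|c| = 1 -> square_symmetries e0 c%:M.
Proof.
move=> c1; apply: square_symmetriesP => [|v].
  by rewrite /orthogonal_matrix tr_scalar_mx -scalar_mxM -expr2 -real_normK
    ?num_real// c1 expr1n.
by rewrite mul_scalar_mx !mxE !normrM c1 !mul1r.
Qed.

(** Columns along different axes give a signed permutation, a symmetry of the square. Columns along
    the same axis give a projection up to sign, and [reduce] moves that sign into the symmetry
    [c%:M]. *)
Lemma signed_basis_columns_compositions M : signed_basis_columns M ->
  compositions (diagonal_projections e0 `|` square_symmetries e0) M.
Proof.
have sq1 (c : R) : `|c| = 1 -> c * c = 1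
  by move=> c1; rewrite -expr2 -real_normK ?num_real// c1 expr1n.
have nz (c : R) : `|c| = 1 -> c != 0
  by move=> c1; rewrite -normr_eq0 c1 oner_eq0.
have reduce (c : R) P : `|c| = 1 -> M = c *: P -> diagonal_projections e0 P ->
    compositions (diagonal_projections e0 `|` square_symmetries e0) M.
  move=> c1 -> PP; rewrite -mul_scalar_mx; apply: compositions_mul.
    by apply: compositions_gen; right; exact: scalar_square_symmetry.
  by apply: compositions_gen; left.
move=> Mc; case: (Mc 0) => -[M00 M10]; case: (Mc 1) => -[M01 M11].
- apply: (reduce (M 0 0) ((M 0 0)^-1 *: M)) => //; first
  by rewrite scalerA mulfV ?scale1r ?nz.
  by apply: projection_row0;
    rewrite !mxE ?M10 ?M11 ?mulr0 ?mulVf ?nz// normrM normfV M00 M01 invr1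
      mulr1.
- apply: compositions_gen; right; apply: square_symmetriesP => [|v].
    by apply: mx2P; rewrite mulmx2E !mxE /= ?M01 ?M10 ?(mulr0, mul0r, addr0,
      add0r) ?sq1.
  by rewrite !mulmx2E M01 M10 !mul0r addr0 add0r !normrM M00 M11 !mul1r.
- apply: compositions_gen; right; apply: square_symmetriesP => [|v].
    by apply: mx2P; rewrite mulmx2E !mxE /= ?M00 ?M11 ?(mulr0, mul0r, addr0,
      add0r) ?sq1.
  by rewrite !mulmx2E M00 M11 !mul0r addr0 add0r !normrM M01 M10 !mul1r addrC.
- apply: (reduce (M 1 1) ((M 1 1)^-1 *: M)) => //; first
  by rewrite scalerA mulfV ?scale1r ?nz.
  by apply: projection_row1;
    rewrite !mxE ?M00 ?M01 ?mulr0 ?mulVf ?nz// normrM normfV M11 M10 invr1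
      mulr1.
Qed.

End Square.

(** * Recurrence of powers, and inverses as limits of powers *)

Section Recurrence.
Context {R : realType}.
Implicit Types (A B J : 'M[R]_2) (S : set 'M[R]_2) (z w : R[i]).

Lemma closed_mx_approx m n (S : set 'M[R]_(m, n)) (A : 'M[R]_(m, n)) :
  closed S ->
  (forall e, 0 < e -> exists2 B : 'M[R]_(m, n), S B & forall i j, `|A i j - B i
    j| < e) -> S A.
Proof.
move=> clS SA; apply: clS => U /nbhs_ballP[e /= e0 AU].
by have [B SB AB] := SA e e0; exists B; split => //; apply: AU;
  split => // i j; exact: AB.
Qed.

Lemma semigroup_expr S A n : matrix_semigroup S -> S A -> S (A ^+ n.+1).
Proof.
by move=> [SM _] SA; elim: n => [|n IHn]; rewrite ?expr1// exprS; apply: SM.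
Qed.

Lemma mx_entry_le_sum m n (A : 'M[R]_(m, n)) i j :
  `|A i j| <= \sum_k \sum_l `|A k l|.
Proof.
rewrite (bigD1 i)//= (bigD1 j)//= -addrA lerDl addr_ge0 ?sumr_ge0// => k _.
by rewrite sumr_ge0.
Qed.

Lemma expr_small (q e : R) : `|q| < 1 -> 0 < e -> exists n, `|q| ^+ n < e.
Proof.
move=> q1 e0; have /cvgr0Pnorm_lt/(_ _ e0)[n _ nq] := cvg_expr q1.
by exists n; have := nq n (leqnn n); rewrite normrX.
Qed.

Lemma normc_le_ReIm z : normc z <= `|complex.Re z| + `|complex.Im z|.
Proof.
rewrite -ler_sqr ?nnegrE ?normc_ge0 ?addr_ge0// sqr_normc sqrrD !real_normK
  ?num_real//.
by rewrite lerD2r lerDl mulrn_wge0 ?mulr_ge0.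
Qed.

Lemma Re_le_normc z : `|complex.Re z| <= normc z.
Proof.
rewrite -ler_sqr ?nnegrE ?normc_ge0 ?addr_ge0// sqr_normc !real_normK
  ?num_real//.
by rewrite lerDl sqr_ge0.
Qed.

Lemma Im_le_normc z : `|complex.Im z| <= normc z.
Proof.
rewrite -ler_sqr ?nnegrE ?normc_ge0 ?addr_ge0// sqr_normc !real_normK
  ?num_real//.
by rewrite lerDr sqr_ge0.
Qed.

Lemma ReB z w : complex.Re (z - w) = complex.Re z - complex.Re w.
Proof. by case: z w => [a b] [c d]. Qed.

Lemma ImB z w : complex.Im (z - w) = complex.Im z - complex.Im w.
Proof. by case: z w => [a b] [c d]. Qed.

(** The powers of [z] stay in a compact square, so two of them, [z ^+ k] and [z ^+ m], are close to
    a cluster point; dividing by [z ^+ k] preserves the distance. *)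
Lemma unit_circle_recurrence z e : normc z = 1 -> 0 < e ->
  exists n, normc (z ^+ n.+2 - 1) < e.
Proof.
move=> z1 e0; pose f k : R * R := (complex.Re (z ^+ k), complex.Im (z ^+ k)).
have zn k : normc (z ^+ k) = 1 by rewrite normcX z1 expr1n.
have cK := compact_setX (@segment_compact R (-1) 1) (@segment_compact R (-1) 1).
have [|p [_ clp]] := cK (f @ \oo) _.
  exists 0%N => // k _; split; rewrite /= in_itv /= -ler_norml -(zn k).
    exact: Re_le_normc.
  exact: Im_le_normc.
have e4 : 0 < e / 4 by lra.
have near_p n : exists2 k, (n <= k)%N & ball p (e / 4) (f k).
  have [|_ [[k /= nk <-] fk]] := clp (f @` [set k | (n <= k)%N]) _ _
    (nbhsx_ballx p _ e4).
    by exists n => // k nk; exists k.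
  by exists k.
(* A gap of at least 2 leaves, after one factor [z] is removed, a positive power to approximate the
   inverse. *)
have [k _ [k1 k2]] := near_p 0%N; have [m km [m1 m2]] := near_p k.+2.
exists (m - k.+2)%N.
have mE : m = (k + (m - k.+2).+2)%N by rewrite -!addSnnS subnKC.
have -> : normc (z ^+ (m - k.+2).+2 - 1) = normc (z ^+ m - z ^+ k).
  by rewrite [in RHS]mE exprD -{2}[z ^+ k]mulr1 -mulrBr normcM zn mul1r.
apply: le_lt_trans (normc_le_ReIm _) _; rewrite ReB ImB.
move: k1 k2 m1 m2; rewrite /ball /= => k1 k2 m1 m2.
have d1 := ler_distD p.1 (complex.Re (z ^+ m)) (complex.Re (z ^+ k)).
have d2 := ler_distD p.2 (complex.Im (z ^+ m)) (complex.Im (z ^+ k)).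
rewrite distrC in m1; rewrite distrC in m2; lra.
Qed.

(** For [J *m J = - 1%:M] this embeds the complex numbers into the matrices, with i sent to [J]. *)
Definition complex_mx J z : 'M[R]_2 := (complex.Re z)%:M + complex.Im z *: J.

Lemma complex_mxM J z w : J *m J = - 1%:M ->
  complex_mx J (z * w) = complex_mx J z *m complex_mx J w.
Proof.
move=> JJ; rewrite /complex_mx mulmxDl !mulmxDr -!scalemxAl -!scalemxAr JJ.
rewrite !mul_scalar_mx mul_mx_scalar; case: z w => [a b] [c d] /=.
by apply/matrixP => i j; rewrite !mxE; ring.
Qed.

Lemma complex_mxX J z n : J *m J = - 1%:M ->
  complex_mx J (z ^+ n) = complex_mx J z ^+ n.
Proof.
move=> JJ; elim: n => [|n IHn]; first by rewrite /complex_mx /= scale0r addr0.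
by rewrite !exprS complex_mxM// IHn.
Qed.

(** When [z ^+ n.+2] is close to 1, [z ^+ n.+1] is close to the inverse of [z], which is its
    conjugate; closedness concludes. *)
Lemma semigroup_complex_mx_inv S J z : matrix_semigroup S -> J *m J = - 1%:M ->
  normc z = 1 -> S (complex_mx J z) -> S (complex_mx J (conjc z)).
Proof.
move=> semS JJ z1 SA; apply: closed_mx_approx => [|e e0]; first by case: semS.
(* The entries of [complex_mx J w] are at most [normc w * K]. *)
pose K := 1 + \sum_i \sum_j `|J i j|.
have JK i j : `|J i j| <= K - 1 by rewrite /K addrC addKr mx_entry_le_sum.
have K0 : 0 < K by have := JK 0 0; have := normr_ge0 (J 0 0); lra.
have [n nz] := unit_circle_recurrence z (e / K) z1 (divr_gt0 e0 K0).
exists (complex_mx J z ^+ n.+1) => [|i j]; first exact: semigroup_expr.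
have zz : conjc z * z = 1.
  move: (sqr_normc z); rewrite z1 expr1n; case: z {z1 SA nz} => a b /= ab.
  apply/eqP; rewrite eq_complex /=; apply/andP; split; apply/eqP; last ring.
  by rewrite ab; ring.
pose w := conjc z - z ^+ n.+1.
have w1 : normc w < e / K.
  have -> : normc w = normc (z ^+ n.+2 - 1); last exact: nz.
  have -> : z ^+ n.+2 - 1 = z * (- w).
    by rewrite /w opprB mulrBr -exprS [z * _]mulrC zz.
  by rewrite normcM z1 !mul1r normcN.
have -> : complex_mx J (conjc z) i j - (complex_mx J z ^+ n.+1) i j =
  complex_mx J w i j.
  by rewrite -complex_mxX// !mxE ReB ImB; ring.
rewrite !mxE; apply: le_lt_trans (ler_normD _ _) _.
have h1 : `|complex.Re w *+ (i == j)| <= normc w.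
  apply: le_trans (Re_le_normc w); case: (i == j);
    rewrite ?mulr1n ?mulr0n ?normr0//.
have h2 : `|complex.Im w * J i j| <= normc w * (K - 1).
  by rewrite normrM ler_pM// Im_le_normc.
apply: le_lt_trans (lerD h1 h2) _.
by move: w1; rewrite ltr_pdivlMr//; lra.
Qed.

End Recurrence.

(** * Determinants of modulus 1, and criteria for orthogonality *)

Section RankTwo.
Context {R : realType}.
Implicit Types (A B M N T : 'M[R]_2) (S : set 'M[R]_2) (x : 'cV[R]_2).

Lemma cayley_hamilton2 A : A *m A = \tr A *: A - (\det A)%:M.
Proof.
by rewrite det_mx2 mxtrace2; apply: mx2P; rewrite mulmx2E !mxE /=; ring.
Qed.

Lemma det_neq0_rank2 A : (2 <= \rank A)%N -> \det A != 0.
Proof.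
move=> rA; rewrite -unitfE -unitmxE -row_free_unit /row_free eqn_leq rA andbT.
exact: rank_leq_row.
Qed.

Lemma semigroup_det_norm1 S A : matrix_semigroup S ->
  (forall B, S B -> is_spectral_radius B 1) -> (forall B, S B -> \det B != 0) ->
  S A -> `|\det A| = 1.
Proof.
move=> semS rad1 det0 SA;
  have [[-> _]|[tA dA]] := spectral_radius1P _ (rad1 _ SA).
  by rewrite normr1.
have [q qE] : {q | q = (\det A) ^+ 2} by exists (\det A ^+ 2).
have [//|dA1] := eqVneq `|\det A| 1; exfalso.
have q1 : `|q| < 1 by rewrite qE normrX exprn_ilt1 ?normr_ge0// lt_neqAle dA1.
have q1' : 1 - q != 0
  by rewrite subr_eq0 eq_sym; apply: contraTneq q1 => ->; rewrite normr1 ltxx.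
(* Squaring removes the sign of [\tr A]: the eigenvalues of [B] are 1 and [q]. *)
have [B BE] : {B | B = A *m A} by exists (A *m A).
have BB : B *m B = (1 + q) *: B - q%:M.
  rewrite cayley_hamilton2 BE det_mulmx -expr2 -qE; congr (_ *: _ - _).
  rewrite cayley_hamilton2 raddfB /= mxtraceZ mxtrace_scalar.
  rewrite -expr2 -[\tr A ^+ 2]real_normK ?num_real// tA qE; ring.
(* The spectral projection of [B] for the eigenvalue 1. It is singular and is the limit of the
   powers of [B]. *)
pose P := (1 - q)^-1 *: (B - q%:M).
have BP : B *m P = P.
  rewrite /P -scalemxAr mulmxBr BB mul_mx_scalar; congr (_ *: _).
  by apply/matrixP => i j; rewrite !mxE; ring.
have BnP n : B ^+ n = P + q ^+ n *: (1%:M - P).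
  elim: n => [|n IHn]; first by rewrite expr0 scale1r addrC subrK.
  have -> : B ^+ n.+1 = B *m B ^+ n by rewrite exprS.
  rewrite IHn mulmxDr BP -scalemxAr mulmxBr BP mulmx1 exprSr -scalerA.
  congr (_ + _ *: _); rewrite /P; apply/matrixP => i j; rewrite !mxE; field.
  exact: q1'.
have SP : S P.
  apply: closed_mx_approx => [|e e0]; first by case: semS.
  pose K := 1 + \sum_i \sum_j `|(1%:M - P) i j|.
  have KP i j : `|(1%:M - P) i j| < K.
    by have := mx_entry_le_sum _ _ (1%:M - P) i j; rewrite /K; lra.
  have K0 : 0 < K by apply: le_lt_trans (KP 0 0).
  have [n qn] := expr_small q (e / K) q1 (divr_gt0 e0 K0).
  exists (B ^+ n.+1) => [|i j].
    by apply: semigroup_expr => //; rewrite BE; case: semS => SM _; apply: SM.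
  rewrite BnP !mxE opprD addrA subrr sub0r normrN normrM normrX.
  have := KP i j; rewrite !mxE => KPij.
  rewrite ltr_pdivlMr// in qn; apply: le_lt_trans qn; apply: ler_pM => //.
  - by rewrite exprS ler_piMl ?exprn_ge0// ltW.
  - exact: ltW.
have /eqP[] := det0 _ SP; rewrite detZ.
have -> : \det (B - q%:M) = 0; last by rewrite mulr0.
have : \tr B = 1 + q /\ \det B = q.
  split; last by rewrite BE det_mulmx -expr2.
  rewrite BE cayley_hamilton2 raddfB /= mxtraceZ mxtrace_scalar.
  rewrite -expr2 -[\tr A ^+ 2]real_normK ?num_real// tA qE; ring.
rewrite !det_mx2 mxtrace2 !mxE /= => -[trB detB].
have B11 : B 1 1 = 1 + q - B 0 0 by lra.
by rewrite B11 in detB *; rewrite mulr0n !subr0; lra.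
Qed.

(** For [\det N = 0] it shows that [B] preserves the line of [N *m x] as soon as
    [\tr (N *m B) = 0]. *)
Lemma cross_nilpotent N B x : \tr N = 0 ->
  cross (N *m x) (B *m (N *m x)) =
  - (\tr (N *m B) * cross x (N *m x)) - \det N * cross x (B *m x).
Proof.
rewrite mxtrace2 => trN; have {trN} N11 : N 1 1 = - N 0 0.
  by apply/eqP; rewrite -addr_eq0 addrC trN.
by rewrite /cross det_mx2 mxtrace2 !mulmx2E N11; ring.
Qed.

Lemma bounded_affine_sequence (a b K : R) :
  (forall n, `|a + n.+1%:R * b| <= K) -> b = 0.
Proof.
move=> ab; apply/eqP; apply/negPn/negP => b0; have bp : 0 < `|b|
  by rewrite normr_gt0.
pose n := Num.truncn ((K + `|a|) / `|b|).
have := truncnS_gt ((K + `|a|) / `|b|); rewrite -/n ltr_pdivrMr// => nb.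
have := ab n; have := ler_normB (a + n.+1%:R * b) a.
by rewrite [a + _]addrC addrK normrM ger0_norm//; lra.
Qed.

(** The two basis vectors kill the off-diagonal entries; their sum equates the diagonal ones. *)
Lemma scalar_mx_cross A : (forall x, cross x (A *m x) = 0) -> A = (A 0 0)%:M.
Proof.
move=> A0; have := A0 (\col_i (i == 0)%:R); have := A0 (\col_i (i == 1)%:R).
have := A0 (\col_i 1); rewrite /cross !mulmx2E !mxE /= => h1 h2 h3.
by apply: mx2P; rewrite !mxE /=; lra.
Qed.

(** The sum of squares minus [2 * \det M] is the sum of the squares of [M 0 0 - M 1 1] and
    [M 0 1 + M 1 0], so both vanish. *)
Lemma orthogonal_det1 M : \det M = 1 ->
  M 0 0 ^+ 2 + M 0 1 ^+ 2 + M 1 0 ^+ 2 + M 1 1 ^+ 2 <= 2 -> orthogonal_matrix M.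
Proof.
rewrite det_mx2 => d1 n2.
have h : (M 0 0 - M 1 1) ^+ 2 + (M 0 1 + M 1 0) ^+ 2 <= 0 by nra.
have s1 := sqr_ge0 (M 0 0 - M 1 1); have s2 := sqr_ge0 (M 0 1 + M 1 0).
have /eqP : (M 0 0 - M 1 1) ^+ 2 = 0 by lra.
have /eqP : (M 0 1 + M 1 0) ^+ 2 = 0 by lra.
rewrite !expf_eq0 /= subr_eq0 addr_eq0 => /eqP e1 /eqP e2.
by rewrite e1 e2 in d1 *; apply: mx2P; rewrite mulmx2E !mxE ?e1 ?e2 /=; lra.
Qed.

Lemma orthogonal_detN1 M : \det M = -1 -> \tr M = 0 -> M 0 1 = M 1 0 ->
  orthogonal_matrix M.
Proof.
rewrite det_mx2 mxtrace2 => dM tM sM; have M11 : M 1 1 = - M 0 0 by lra.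
rewrite sM M11 in dM.
by apply: mx2P; rewrite mulmx2E !mxE ?sM ?M11 /=; lra.
Qed.

Lemma rotation_trace z M : \tr (complex_mx quarter_turn z *m M) =
  complex.Re z * \tr M + complex.Im z * (M 0 1 - M 1 0).
Proof. by rewrite !mxtrace2 !mulmx2E !mxE /=; ring. Qed.

(** For [c ^+ 2 + s ^+ 2 = 1] and [\det M = 1], the last two factors are the inverses of the first
    two, so this is the trace of a commutator with a rotation. *)
Lemma commutator_trace (c s : R) M :
  \tr ((c%:M + s *: quarter_turn) *m M *m (c%:M - s *: quarter_turn) *m
       ((\tr M)%:M - M)) =
  2 * c ^+ 2 * \det M +
  s ^+ 2 * (M 0 0 ^+ 2 + M 0 1 ^+ 2 + M 1 0 ^+ 2 + M 1 1 ^+ 2).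
Proof. by rewrite !mxtrace2 det_mx2 !mulmx2E !mxE /=; ring. Qed.

(** The basis consists of the first unit vector and its image under [J]; they are independent
    because [J] has no real eigenvalue. *)
Lemma complex_structure_basis J : J *m J = - 1%:M :> 'M[R]_2 ->
  exists2 T, T \in unitmx & J *m T = T *m quarter_turn.
Proof.
move=> /matrixP JJ; have := JJ 0 0; have := JJ 1 0;
  rewrite !mulmx2E !mxE /= => J1 J0.
have J10 : J 1 0 != 0.
  by apply/eqP => J10; have := sqr_ge0 (J 0 0); rewrite J10 in J0; lra.
exists (\matrix_(i, j) (if j == 0 then (i == 0)%:R else J i 0)).
  by rewrite unitmxE unitfE det_mx2 !mxE /= mul1r mulr0 subr0.
by apply: mx2P; rewrite !mulmx2E !mxE /=; lra.
Qed.

(** * Semigroups of invertible matrices with spectral radius 1 *)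

Section Group.
Variable S : set 'M[R]_2.
Hypotheses (semS : matrix_semigroup S) (irrS : irreducible_family S).
Hypotheses (rad1 : forall B, S B -> is_spectral_radius B 1).
Hypotheses (det0 : forall B, S B -> \det B != 0).

Let SM A B : S A -> S B -> S (A *m B).
Proof. by case: semS => SM _; apply: SM. Qed.

Lemma semigroup_det_trace A : S A ->
  (\det A = 1 /\ `|\tr A| <= 2) \/ (\det A = -1 /\ \tr A = 0).
Proof.
move=> SA; have [[dA tA]|[tA _]] := spectral_radius1P _ (rad1 _ SA).
  by left; rewrite dA ltW.
have := semigroup_det_norm1 _ _ semS rad1 det0 SA.
move=> /eqP; rewrite eqr_norml ler01 andbT => /orP[]/eqP dA.
  by left; rewrite tA dA.
by right; split=> //; apply/normr0_eq0; rewrite tA dA subrr.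
Qed.

Lemma semigroup_trace_le2 A : S A -> `|\tr A| <= 2.
Proof. by case/semigroup_det_trace => -[_] // ->; rewrite normr0. Qed.

Lemma semigroup_nonscalar_trace A x : S A -> \det A = 1 ->
  cross x (A *m x) != 0 -> `|\tr A| < 2.
Proof.
move=> SA dA Ax; rewrite lt_neqAle semigroup_trace_le2// andbT;
  apply/negP => tA.
(* [e] is the double eigenvalue, 1 or -1, and [N] below is the nilpotent part of [A]. *)
pose e := \tr A / 2; have trE : \tr A = 2 * e by rewrite /e; field.
have ee : e ^+ 2 = 1.
  move: tA; rewrite eqr_norml ler0n andbT.
  by rewrite /e => /orP[]/eqP ->; field.
pose N := A - e%:M.
have xN : cross x (N *m x) = cross x (A *m x).
  by rewrite /cross !mulmx2E !mxE /=; ring.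
have trN : \tr N = 0 by rewrite raddfB /= mxtrace_scalar trE; ring.
have detN : \det N = 0.
  move: dA trE; rewrite !det_mx2 mxtrace2 !mxE /= => dA trA.
  have A11 : A 1 1 = 2 * e - A 0 0 by rewrite -trA; ring.
  by rewrite A11 in dA *; rewrite mulr0n !subr0; nra.
have NN : N *m N = 0 by rewrite cayley_hamilton2 trN detN scale0r raddf0 subr0.
have An n : (A *m A) ^+ n = 1%:M + (n%:R * (2 * e)) *: N.
  have AA : A *m A = 1%:M + (2 * e) *: N.
    rewrite cayley_hamilton2 dA trE /N scalerBr scale_scalar_mx.
    have -> : 2 * e * e = 2 by rewrite -mulrA -expr2 ee mulr1.
    by apply/matrixP => i j; rewrite !mxE; ring.
  elim: n => [|n IHn]; first by rewrite mul0r scale0r addr0 expr0.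
  have -> : (A *m A) ^+ n.+1 = (A *m A) *m (A *m A) ^+ n by rewrite exprS.
  rewrite IHn {1}AA mulmxDl mul1mx mulmxDr mulmx1 -scalemxAr -scalemxAl NN
    !scaler0 addr0.
  by apply/matrixP => i j; rewrite !mxE -natr1; ring.
have y0 : N *m x != 0.
  apply: contraNneq Ax => Nx; rewrite -xN Nx /cross !mxE; apply/eqP; ring.
have [B SB] := irreducible_cross S _ irrS y0; case/eqP.
rewrite cross_nilpotent// detN mul0r subr0.
suff -> : \tr (N *m B) = 0 by rewrite mul0r oppr0.
have e0 : 2 * e != 0.
  by apply/eqP => e0; move: ee; rewrite (_ : e = 0) ?expr0n /=; lra.
(* The trace of [(A *m A) ^+ n.+1 *m B] is affine in [n] with slope [2 * e * \tr (N *m B)], and is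
   bounded by 2. *)
apply: (mulfI e0); rewrite mulr0;
  apply: (bounded_affine_sequence (\tr B) _ 2) => n.
have SAn : S ((A *m A) ^+ n.+1) by apply: semigroup_expr => //; exact: SM.
have := semigroup_trace_le2 _ (SM _ _ SAn SB).
by rewrite An mulmxDl mul1mx -scalemxAl mxtraceD mxtraceZ -mulrA.
Qed.

(** An element [A] of determinant -1 has trace 0, so it is an involution fixing [x]. Some [C] moves
    the line of [x]; if [\det C = -1] too, then [A *m C] has determinant 1 and also moves it. *)
Lemma semigroup_nonscalar_exists : exists A x,
  [/\ S A, \det A = 1 & cross x (A *m x) != 0].
Proof.
have u0 : (delta_mx 0 0 : 'cV[R]_2) != 0.
  by apply/eqP => /matrixP/(_ 0 0)/eqP; rewrite !mxE oner_eq0.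
have [A SA Au] := irreducible_cross S _ irrS u0.
have [[dA _]|[dA tA]] := semigroup_det_trace _ SA; first
  by exists A, (delta_mx 0 0).
pose x := (A + 1%:M) *m (delta_mx 0 0 : 'cV[R]_2).
have Axx : A *m x = x.
  by rewrite /x mulmxA mulmxDr cayley_hamilton2 tA dA mulmx1 scale0r sub0r
    raddfN opprK addrC.
have x0 : x != 0.
  apply: contraNneq Au => /matrixP/(_ 1 0).
  rewrite /x mulmx2E !mxE /= => h; rewrite /cross !mulmx2E !mxE /=; apply/eqP;
    lra.
have [C SC Cx] := irreducible_cross S _ irrS x0.
have [[dC _]|[dC tC]] := semigroup_det_trace _ SC; first by exists C, x.
exists (A *m C), x; split; [exact: SM |
  by rewrite det_mulmx dA dC mulrNN mulr1 |].
have -> : cross x (A *m C *m x) = \det A * cross x (C *m x).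
  rewrite -{1}Axx -mulmxA /cross det_mx2 !mulmx2E; ring.
by rewrite mulf_neq0// dA oppr_eq0 oner_eq0.
Qed.

(** The traceless part of [A] squares to a negative scalar, so it is a multiple of some [J]; [z] is
    then an eigenvalue of [A]. *)
Lemma elliptic_complex_mx A : \det A = 1 -> `|\tr A| < 2 ->
  exists J z, [/\ J *m J = - 1%:M, normc z = 1, complex.Im z != 0,
    A = complex_mx J z & (\tr A)%:M - A = complex_mx J (conjc z)].
Proof.
move=> dA tA; pose c := \tr A / 2; pose s := Num.sqrt (1 - c ^+ 2).
have trE : \tr A = 2 * c by rewrite /c; field.
have c1 : c ^+ 2 < 1.
  by move: tA; rewrite trE ltr_norml => /andP[? ?]; nra.
have s2 : s ^+ 2 = 1 - c ^+ 2 by rewrite sqr_sqrtr// subr_ge0 ltW.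
have s0 : s != 0 by apply/eqP => s0; move: s2; rewrite s0 expr0n /=; lra.
exists (s^-1 *: (A - c%:M)), (Complex c s); split=> //.
- rewrite -scalemxAl -scalemxAr scalerA mulmxBl !mulmxBr cayley_hamilton2 dA
  trE.
  rewrite !mul_scalar_mx mul_mx_scalar scale_scalar_mx.
  have -> : 2 * c *: A - 1%:M - c *: A - (c *: A - (c * c)%:M) = (- s ^+ 2)%:M.
    by rewrite s2; apply/matrixP => i j; rewrite !mxE; case: (i == j);
      rewrite /= ?mulr0n ?mulr1n; ring.
  rewrite scale_scalar_mx -raddfN /=; congr _%:M; field.
  exact: s0.
- by rewrite /= s2 addrC subrK sqrtr1.
- by rewrite /complex_mx /= scalerA mulfV// scale1r addrC subrK.
- rewrite /complex_mx /= scalerA mulNr mulfV// scaleN1r trE.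
  by apply/matrixP => i j; rewrite !mxE; case: (i == j);
    rewrite /= ?mulr0n ?mulr1n; ring.
Qed.

(** By Cayley-Hamilton, [(\tr A)%:M - A] is the inverse of [A]. *)
Lemma semigroup_elliptic_inv A : S A -> \det A = 1 -> `|\tr A| < 2 ->
  S ((\tr A)%:M - A).
Proof.
move=> SA dA tA; have [J [z [JJ z1 _ AE ->]]] := elliptic_complex_mx _ dA tA.
by apply: semigroup_complex_mx_inv => //; rewrite -AE.
Qed.

Lemma rank2_semigroup : exists2 T, T \in unitmx &
  forall B, S B -> orthogonal_matrix (invmx T *m B *m T).
Proof.
have [A [x [SA dA Ax]]] := semigroup_nonscalar_exists.
have tA := semigroup_nonscalar_trace _ _ SA dA Ax.
have SA' := semigroup_elliptic_inv _ SA dA tA.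
have [J [z [JJ z1 z0 AE A'E]]] := elliptic_complex_mx _ dA tA.
have [T Tu JT] := complex_structure_basis _ JJ.
exists T => // B SB; pose conj X := invmx T *m X *m T.
have conjM X Y : conj (X *m Y) = conj X *m conj Y.
  by rewrite /conj !mulmxA -[_ *m T *m invmx T]mulmxA mulmxV// mulmx1.
have conjC c : conj c%:M = c%:M.
  by rewrite /conj mul_mx_scalar -scalemxAl mulVmx// scalemx1.
have conj_tr X : \tr (conj X) = \tr X
  by rewrite mxtrace_mulC mulmxA mulmxV// mul1mx.
have conj_det X : \det (conj X) = \det X.
  by rewrite !det_mulmx mulrAC -det_mulmx mulVmx// det1 mul1r.
have conjB X Y : conj (X - Y) = conj X - conj Y
  by rewrite /conj mulmxBr mulmxBl.
have conjJ : conj J = quarter_turn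
  by rewrite /conj -mulmxA JT mulmxA mulVmx// mul1mx.
have conj_complex w : conj (complex_mx J w) = complex_mx quarter_turn w.
  rewrite /complex_mx -conjJ -[in RHS](conjC (complex.Re w)) /conj.
  by rewrite mulmxDr mulmxDl -scalemxAr -scalemxAl.
rewrite -/(conj B); set M := conj B.
(* In determinant -1, the traces of [B] and [A *m B] vanish; since [A] is a rotation by a nonzero
   angle, this makes [M] symmetric. *)
have [[dB tB]|[dB tB]] := semigroup_det_trace _ SB; last first.
  have dAB : \det (A *m B) = -1 by rewrite det_mulmx dA dB mul1r.
  have [[]|[_ tAB]] := semigroup_det_trace _ (SM _ _ SA SB); first
    by rewrite dAB; lra.
  apply: orthogonal_detN1; rewrite ?conj_det ?conj_tr//.
  move: tAB; rewrite -conj_tr conjM AE conj_complex rotation_trace conj_tr tB.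
  by rewrite mulr0 add0r => /eqP; rewrite mulf_eq0 (negPf z0) subr_eq0 => /eqP.
have [[y By]|Bscal] := pselect (exists y, cross y (B *m y) != 0); last first.
  have BE : B = (B 0 0)%:M.
    by apply: scalar_mx_cross => y; apply/eqP/negPn/negP => By; apply: Bscal;
      exists y.
  rewrite /M BE conjC /orthogonal_matrix tr_scalar_mx -scalar_mxM.
  by move: dB; rewrite BE det_scalar !mxE /= mulr1n expr2 => ->.
have SB' := semigroup_elliptic_inv _ SB dB (semigroup_nonscalar_trace _ _ SB dB
  By).
apply: orthogonal_det1; rewrite ?conj_det//.
(* The commutator lies in [S], so its trace is at most 2; this bounds the sum of squares of the
   entries of [M] by 2. *)
have := semigroup_trace_le2 _ (SM _ _ (SM _ _ (SM _ _ SA SB) SA') SB').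
rewrite -conj_tr !conjM A'E AE !conj_complex conjB conjC -(conj_tr B) -/M.
have -> : complex_mx quarter_turn (conjc z) =
    (complex.Re z)%:M - complex.Im z *: quarter_turn.
  by case: (z) => a b; rewrite /complex_mx /= scaleNr.
rewrite commutator_trace {1}/M conj_det dB ler_norml => /andP[_ h].
have cs : complex.Re z ^+ 2 + complex.Im z ^+ 2 = 1
  by rewrite -sqr_normc z1 expr1n.
have s2 : 0 < complex.Im z ^+ 2 by rewrite exprn_even_gt0.
by rewrite -(ler_pM2l s2); lra.
Qed.

End Group.
End RankTwo.

(** * Choice of the basis and of the square according to the rank *)

Theorem proposition8 (R : realType) (S : set 'M[R]_2) (r : nat)
    (semigroupS : matrix_semigroup S)
    (irreducibleS : irreducible_family S)
    (csrS : constant_spectral_radius S)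
    (min_rank_r : is_min_rank S r) :
  exists2 T : 'M[R]_2, T \in unitmx &
    (r = 2%N -> forall A, change_basis T S A -> orthogonal_matrix A) /\
    (r = 1%N -> exists2 p : 'cV[R]_2, p != 0 &
       change_basis T S `<=`
       compositions (diagonal_projections p `|` square_symmetries p)).
Proof.
have rad1 A : S A -> is_spectral_radius A 1.
  exact: constant_spectral_radius_eq1.
case: min_rank_r => [[A SA rA] minr].
have [r2|r2] := eqVneq r 2%N.
  rewrite r2 in minr; have [T Tu ST] := rank2_semigroup S semigroupS
    irreducibleS rad1
    (fun B SB => det_neq0_rank2 _ (minr B SB)).
  exists T => //; split=> [_ _ [B SB <-]|rE]; first exact: ST.
  by rewrite rE in r2.
have [r1|r1] := eqVneq r 1%N; last first.
  (* Both implications are vacuous for other ranks. *)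
  by exists 1%:M; [exact: unitmx1 | split=> rE;
    [rewrite rE in r2 | rewrite rE in r1]].
have [T Tu ST] := rank1_semigroup S semigroupS irreducibleS rad1
  (ex_intro2 _ _ A SA (etrans rA r1)).
exists T => //; split=> [rE|_]; first by rewrite rE in r2.
(* The diagonals of the square are the axes of the new basis. *)
exists (delta_mx 0 0) => [|_ [B SB <-]].
  by apply/eqP => /matrixP/(_ 0 0)/eqP; rewrite !mxE oner_eq0.
exact/signed_basis_columns_compositions/ST.
Qed.
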